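(* Let $q$ be a complex number with $|q|<1$. Then $$\sum_{m=0}^{\infty}\frac{q^{m^2}}{(q)_m}=\prod_{m=0}^{\infty}\frac{1}{(1-q^{5m+1})(1-q^{5m+4})}$$ and $$\sum_{m=0}^{\infty}\frac{q^{m^2+m}}{(q)_m}=\prod_{m=0}^{\infty}\frac{1}{(1-q^{5m+2})(1-q^{5m+3})}.$$
   Context: $(q)_m:=\prod_{j=1}^{m}(1-q^j)$, with $(q)_0=1$. Convention $0^0=1$. *)

(* Defs.v *)
From HB Require Import structures.
From mathcomp Require Import all_boot all_order all_algebra.
From mathcomp Require Import all_classical all_reals all_analysis.
Set Implicit Arguments.
Unset Strict Implicit.
Unset Printing Implicit Defensive.
Import Order.TTheory GRing.Theory Num.Theory.
Import numFieldNormedType.Exports.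
Local Open Scope classical_set_scope.
Local Open Scope ring_scope.

Definition qpoch (K : comPzRingType) (q : K) (m : nat) : K :=
  \prod_(1 <= j < m.+1) (1 - q ^+ j).

Definition series_cvg_to (K : numFieldType) (u : nat -> K) (l : K) : Prop :=
  series u @ \oo --> l.

(* Strict convergence of an infinite product: the limit of the partial products
   must be nonzero. Since [x / 0 = 0], this also rules out factors
   with a vanishing denominator. *)
Definition infprod_cvg_to (K : numFieldType) (u : nat -> K) (l : K) : Prop :=
  (\prod_(0 <= m < n) u m) @[n --> \oo] --> l /\ l != 0.

(* Main.v *)
Require Import Defs.
From HB Require Import structures.
From mathcomp Require Import all_boot all_order all_algebra.
From mathcomp Require Import complex ring lra zify.
From mathcomp Require Import all_classical all_reals all_analysis.
Set Implicit Arguments.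
Unset Strict Implicit.
Unset Printing Implicit Defensive.
Import Order.TTheory GRing.Theory Num.Theory.
Import numFieldNormedType.Exports.
Local Open Scope classical_set_scope.
Local Open Scope ring_scope.
Local Open Scope complex_scope.

(** The proof goes through finite identities in the style of Bailey chains,
    followed by a passage to the limit.

    Write (q)_n for the q-Pochhammer product and fix c = 0 or c = 1, one value
    for each identity.  A sequence a has the Bailey transform
    b_n = sum_{r <= n} a_r / ((q)_{n-r} (q)_{n+r+c}).  Multiplying a_r by
    q^(r^2 + c r) replaces b_n by sum_{s <= n} q^(s^2 + c s) b_s / (q)_{n-s}
    ([bailey_lemma]); this is a disguised q-Vandermonde sum
    ([q_vandermonde]).  For an explicit signed sequence a the transform is the
    indicator of n = 0 ([unit_bailey0], [unit_bailey1]: the partial sums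
    telescope).  Two steps of the chain then give
      sum_{r <= n} a''_r / ((q)_{n-r} (q)_{n+r+c})
        = sum_{s <= n} q^(s^2 + c s) / ((q)_s (q)_{n-s}),
    where a''_r = q^(2 (r^2 + c r)) a_r.

    As n tends to infinity, every factor depending on n - r or n + r converges
    to a power of 1/(q)_oo and stays bounded, while the other factors decay
    geometrically, so the limit may be taken term by term
    ([tannery_geometric], [bailey_limit]):
      sum_s q^(s^2 + c s) / (q)_s = (1/(q)_oo) sum_r a''_r.

    The exponents in a''_r are those of a theta series with base p = q^5: with
    (z, w) = (q^2, q^3) for c = 0 and (z, w) = (q^4, q) for c = 1, the sum of
    a''_r is the bilateral sum of (-z)^r p^(r(r-1)/2), whose negative indices
    are rewritten through w = p/z.  The Jacobi triple product
    ([jacobi_triple_product]), itself a limit of a finite identity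
    ([finite_triple_product]), turns it into
    prod (1 - p^(j+1)) (1 - z p^j) (1 - w p^j).
    Splitting (q)_oo by residues modulo 5 cancels these three classes and
    leaves the two residue classes of the statement.

    The only property of the complex numbers used in the limits is that a
    series dominated by a geometric one converges, so everything else is done
    over a field with a norm having this property ([geometric_complete]). *)

(** * q-Pochhammer symbols and Gaussian binomials *)

Lemma qpoch0 (K : comPzRingType) (q : K) : qpoch q 0 = 1.
Proof. by rewrite /qpoch big_geq. Qed.

Lemma qpochE (K : comPzRingType) (q : K) (n : nat) :
  qpoch q n = \prod_(0 <= k < n) (1 - q ^+ k.+1).
Proof. by rewrite /qpoch big_add1. Qed.

Lemma qpochS (K : comPzRingType) (q : K) (n : nat) :
  qpoch q n.+1 = qpoch q n * (1 - q ^+ n.+1).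
Proof. by rewrite /qpoch big_nat_recr. Qed.

Lemma qpoch_neq0 (F : fieldType) (q : F) (n : nat) :
  (forall k, 1 - q ^+ k.+1 != 0) -> qpoch q n != 0.
Proof.
move=> hq; elim: n => [|n IH]; first by rewrite qpoch0 oner_eq0.
by rewrite qpochS mulf_neq0.
Qed.

Lemma qpoch_mul5 (K : comPzRingType) (q : K) (n : nat) :
  qpoch q (5 * n) =
  \prod_(0 <= m < n) (1 - q ^+ (5 * m + 1)) *
  \prod_(0 <= m < n) (1 - q ^+ (5 * m + 2)) *
  \prod_(0 <= m < n) (1 - q ^+ (5 * m + 3)) *
  \prod_(0 <= m < n) (1 - q ^+ (5 * m + 4)) *
  \prod_(0 <= m < n) (1 - q ^+ (5 * m + 5)).
Proof.
elim: n => [|n IH]; first by rewrite muln0 qpoch0 !big_geq // !mulr1.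
rewrite (_ : (5 * n.+1 = (5 * n).+4.+1)%N); last by lia.
rewrite !qpochS IH !big_nat_recr //= !addnS !addn0; ring.
Qed.

(** The Gaussian binomial coefficient, defined by one of its two Pascal rules
    so that no division is needed; this rule alone carries the inductions on
    the upper index below. *)
Fixpoint qbin (K : comPzRingType) (q : K) (n k : nat) : K :=
  match n, k with
  | _, 0 => 1
  | 0, _.+1 => 0
  | n'.+1, k'.+1 => q ^+ k'.+1 * qbin q n' k'.+1 + qbin q n' k'
  end.

Arguments qbin : simpl never.

Lemma qbinn0 (K : comPzRingType) (q : K) (n : nat) : qbin q n 0 = 1.
Proof. by case: n. Qed.

Lemma qbinS (K : comPzRingType) (q : K) (n k : nat) :
  qbin q n.+1 k.+1 = q ^+ k.+1 * qbin q n k.+1 + qbin q n k.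
Proof. by []. Qed.

Lemma qbin_small (K : comPzRingType) (q : K) (n k : nat) :
  (n < k)%N -> qbin q n k = 0.
Proof.
elim: n k => [|n IH] [|k] //; rewrite ltnS => nk.
by rewrite qbinS !IH ?mulr0 ?addr0 // ltnW.
Qed.

(** The quotient formula with denominators cleared, which makes it valid in
    every commutative ring.  The Pascal rule matches the splitting
    1 - q^(m+k) = q^k (1 - q^m) + (1 - q^k). *)
Lemma qbin_qpoch (K : comPzRingType) (q : K) (m k : nat) :
  qbin q (m + k) k * (qpoch q k * qpoch q m) = qpoch q (m + k).
Proof.
move: {2}(m + k)%N (erefl (m + k)%N) => s.
elim: s m k => [|s IH] m k.
  move/eqP; rewrite addn_eq0 => /andP[/eqP-> /eqP->].
  by rewrite qpoch0 !mul1r.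
case: k => [|k]; first by rewrite qpoch0 qbinn0 addn0 !mul1r.
case: m => [|m] mks.
  have ks : (0 + k = s)%N by lia.
  have := IH 0%N k ks; rewrite !add0n qpoch0 !mulr1 => E.
  by rewrite qbinS qbin_small // qpochS -[in RHS]E; ring.
have E1 := IH m k.+1 ltac:(lia).
have E2 := IH m.+1 k ltac:(lia).
have Ea : (m + k.+1 = m.+1 + k)%N by lia.
rewrite Ea in E1.
have -> : (m.+1 + k.+1 = (m.+1 + k).+1)%N by lia.
have Eb : (m.+1 + k).+1 = (k.+1 + m.+1)%N by lia.
have Ec : 1 - q ^+ (m.+1 + k).+1 =
   q ^+ k.+1 * (1 - q ^+ m.+1) + (1 - q ^+ k.+1).
  by rewrite Eb exprD; ring.
rewrite (qbinS q (m.+1 + k)) [RHS]qpochS Ec [RHS]mulrDr -{1}E1 -E2.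
rewrite (qpochS q m) (qpochS q k); ring.
Qed.

Lemma qbinE (F : fieldType) (q : F) (n k : nat) :
  (forall k, 1 - q ^+ k.+1 != 0) -> (k <= n)%N ->
  qbin q n k = qpoch q n / (qpoch q k * qpoch q (n - k)).
Proof.
move=> hq kn; have := qbin_qpoch q (n - k) k; rewrite subnK // => <-.
by rewrite mulfK // mulf_neq0 ?qpoch_neq0.
Qed.

(** The Pascal rule summed against a test function: each induction on the
    upper index below reduces to a two-term relation on [f]. *)
Lemma sum_qbinS (K : comPzRingType) (q : K) (n : nat) (f : nat -> K) :
  \sum_(0 <= k < n.+2) qbin q n.+1 k * f k =
  \sum_(0 <= k < n.+1) qbin q n k * (q ^+ k * f k + f k.+1).
Proof.
rewrite big_nat_recl // (eq_bigr (fun k =>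
  q ^+ k.+1 * qbin q n k.+1 * f k.+1 + qbin q n k * f k.+1)); last first.
  by move=> k _; rewrite qbinS mulrDl.
rewrite big_split /= addrA.
rewrite [RHS](eq_bigr (fun k => q ^+ k * qbin q n k * f k +
  qbin q n k * f k.+1)); last by move=> k _; ring.
rewrite [RHS]big_split /=; congr (_ + _).
rewrite [RHS]big_nat_recl // [in LHS]big_nat_recr //= (qbin_small q (ltnSn n)) !qbinn0.
by rewrite mulr0 mul0r addr0 expr0 !mul1r.
Qed.

(** * The q-Vandermonde sum and the Bailey lemma *)

(** The q-Vandermonde convolution with one parameter sent to infinity.  The
    summed Pascal rule turns the sum for (n + 1, c) into the sum for
    (n, c + 1): after putting both terms over (q)_{j+c+1}, their numerators are
    proportional to 1 - x and x, where x = q^(j+c+1). *)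
Lemma q_vandermonde (F : fieldType) (q : F) (n c : nat) :
  (forall k, 1 - q ^+ k.+1 != 0) ->
  \sum_(0 <= j < n.+1) qbin q n j * (q ^+ (j * (j + c)) / qpoch q (j + c)) =
  (qpoch q (n + c))^-1.
Proof.
move=> hq; elim: n c => [|n IH] c.
  by rewrite big_nat1 mul0n expr0 !mul1r.
rewrite sum_qbinS addSnnS -IH; apply: eq_bigr => j _; congr (_ * _).
rewrite addSn addnS qpochS.
have -> : (j.+1 * (j + c).+1 = j * (j + c).+1 + (j + c).+1)%N by lia.
have -> : (j * (j + c).+1 = j + j * (j + c))%N by lia.
rewrite !exprD; field.
by rewrite hq qpoch_neq0.
Qed.

(** The Bailey transform relative to the parameter q^c. *)
Definition bailey_sum (F : fieldType) (q : F) (c : nat) (a : nat -> F)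
  (n : nat) : F :=
  \sum_(0 <= r < n.+1) a r / (qpoch q (n - r) * qpoch q (n + r + c)).

(** After exchanging the two sums and setting s = r + j, the exponent splits
    as s^2 + c s = r^2 + c r + j (j + 2 r + c), so the inner sum over j is the
    q-Vandermonde sum with parameters n - r and 2 r + c. *)
Lemma bailey_lemma (F : fieldType) (q : F) (c : nat) (a : nat -> F) (n : nat) :
  (forall k, 1 - q ^+ k.+1 != 0) ->
  bailey_sum q c (fun r => q ^+ (r ^ 2 + c * r) * a r) n =
  \sum_(0 <= s < n.+1)
     q ^+ (s ^ 2 + c * s) / qpoch q (n - s) * bailey_sum q c a s.
Proof.
move=> hq; pose G s r : F := q ^+ (s ^ 2 + c * s) / qpoch q (n - s) *
  (a r / (qpoch q (s - r) * qpoch q (s + r + c))).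
transitivity (\sum_(0 <= s < n.+1) \sum_(0 <= r < n.+1 | (r <= s)%N) G s r);
  last first.
  apply: eq_big_nat => s /andP[_ sn]; rewrite /bailey_sum big_distrr /=.
  rewrite (big_cat_nat (n := s.+1)) //= [X in _ + X]big_nat_cond.
  rewrite [X in _ + X]big_pred0 ?addr0; last first.
    by move=> r; apply/negbTE/negP; lia.
  rewrite big_nat_cond [RHS]big_nat_cond; apply: eq_bigl => r; lia.
rewrite (exchange_big_dep_nat xpredT) //=; apply: eq_big_nat => r /andP[_ rn].
rewrite (big_cat_nat (n := r)) //=; last exact: ltnW.
rewrite big_nat_cond.
rewrite big_pred0 ?add0r; last by move=> s; apply/negbTE/negP; lia.
rewrite (_ : index_iota r n.+1 = index_iota (0 + r) n.+1) // big_addn.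
have hn k := qpoch_neq0 k hq.
have -> : (n.+1 - r = (n - r).+1)%N by lia.
rewrite big_nat_cond (eq_bigl (fun j => (0 <= j < (n - r).+1)%N)); last first.
  by move=> j; lia.
rewrite -big_nat.
transitivity (q ^+ (r ^ 2 + c * r) * a r / qpoch q (n - r) *
   (qpoch q (n - r + (2 * r + c)))^-1).
  have -> : (n - r + (2 * r + c) = n + r + c)%N by lia.
  by field; rewrite !hn.
rewrite -q_vandermonde // big_distrr /=; apply: eq_big_nat => j /andP[_ jn].
rewrite /G; have Ej : (n - r = n - r - j + j)%N by lia.
have := qbin_qpoch q (n - r - j) j; rewrite -Ej => <-.
have -> : (n - (j + r) = n - r - j)%N by lia.
have -> : (j + r - r = j)%N by lia.
have -> : (j + r + r + c = j + (2 * r + c))%N by lia.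
have -> : ((j + r) ^ 2 + c * (j + r) = r ^ 2 + c * r + j * (j + (2 * r + c)))%N.
  by nia.
have qb : qbin q (n - r) j != 0.
  apply/eqP => qb0; have := qbin_qpoch q (n - r - j) j.
  by rewrite -Ej qb0 mul0r => /eqP; rewrite eq_sym (negbTE (hn _)).
by rewrite !exprD; field; rewrite qb !hn.
Qed.

(** * Theta terms and the finite Jacobi triple product *)

(** The term of index [r] >= 0 of the theta series with base [p] at [z]. *)
Definition theta_term (K : comPzRingType) (p z : K) (r : nat) : K :=
  (- z) ^+ r * p ^+ 'C(r, 2).

Lemma theta_term0 (K : comPzRingType) (p z : K) : theta_term p z 0 = 1.
Proof. by rewrite /theta_term !expr0 mulr1. Qed.

Lemma theta_termS (K : comPzRingType) (p z : K) (r : nat) :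
  theta_term p z r.+1 = - z * p ^+ r * theta_term p z r.
Proof. by rewrite /theta_term binS bin1 exprS exprD; ring. Qed.

Lemma theta_term_mulq (K : comPzRingType) (q z : K) (r : nat) :
  theta_term q (z * q) r = q ^+ r * theta_term q z r.
Proof. by rewrite /theta_term -mulNr exprMn; ring. Qed.

(** The factor j = 0 is peeled off, which replaces z by z p in the others. *)
Lemma q_binomial (K : comPzRingType) (p z : K) (m : nat) :
  \prod_(0 <= j < m) (1 - z * p ^+ j) =
  \sum_(0 <= k < m.+1) qbin p m k * theta_term p z k.
Proof.
elim: m z => [|m IH] z.
  by rewrite big_geq // big_nat1 theta_term0 mul1r.
rewrite big_nat_recl // sum_qbinS expr0 mulr1.
under eq_bigr do rewrite exprS mulrA.
rewrite IH big_distrr /=; apply: eq_bigr => k _.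
by rewrite theta_term_mulq theta_termS; ring.
Qed.

(** The terms (-z)^r p^(r(r-1)/2) for r = k - n of either sign.  When z w = p,
    a negative index is a theta term in [w], so no inverse of [z] or [p] is
    taken and the degenerate value p = 0 is included. *)
Definition theta_shift (K : comPzRingType) (p z w : K) (n k : nat) : K :=
  if (n <= k)%N then theta_term p z (k - n) else theta_term p w (n - k).

(** MacMahon's finite form of the Jacobi triple product.  Adding a factor in
    [w] moves the origin of the bilateral sum by one, and the Pascal rule
    absorbs the move; for n = 0 it is the q-binomial theorem. *)
Lemma finite_triple_product (K : comPzRingType) (p z w : K) (m n : nat) :
  z * w = p ->
  (\prod_(0 <= j < m) (1 - z * p ^+ j)) * (\prod_(0 <= j < n) (1 - w * p ^+ j)) =
  \sum_(0 <= k < (m + n).+1) qbin p (m + n) k * theta_shift p z w n k.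
Proof.
move=> zw; elim: n => [|n IH].
  rewrite [X in _ * X]big_geq // mulr1 addn0 q_binomial.
  by apply: eq_bigr => k _; rewrite /theta_shift leq0n subn0.
rewrite addnS sum_qbinS [X in _ * X]big_nat_recr //= mulrA IH big_distrl /=.
apply: eq_bigr => k _; rewrite -mulrA; congr (_ * _).
rewrite {3}/theta_shift ltnS subSS -/(theta_shift p z w n k).
rewrite mulrBr mulr1 addrC; congr (_ + _).
rewrite /theta_shift; case: (ltngtP n k) => nk.
- have [d ->] : exists d, k = (n.+1 + d)%N by exists (k - n.+1)%N; lia.
  rewrite addKn addSnnS addKn theta_termS !exprD exprS.
  move: (theta_term _ _ _) => t; ring: zw.
- have [d ->] : exists d, n = (k + d)%N by exists (n - k)%N; lia.
  rewrite -addnS !addKn theta_termS exprD; ring.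
- rewrite nk subnn subSnn theta_termS !theta_term0 expr0; ring.
Qed.

(** The two unilateral halves both contain the central term, which is
    therefore subtracted once. *)
Lemma finite_triple_product_folded (K : comPzRingType) (p z w : K) (n : nat) :
  z * w = p ->
  (\prod_(0 <= j < n) (1 - z * p ^+ j)) * (\prod_(0 <= j < n) (1 - w * p ^+ j)) =
  \sum_(0 <= r < n.+1) qbin p (n + n) (n + r) * theta_term p z r +
  \sum_(0 <= r < n.+1) qbin p (n + n) (n - r) * theta_term p w r -
  qbin p (n + n) n.
Proof.
move=> zw; rewrite finite_triple_product //.
rewrite (big_cat_nat (n := n)) //=; last by lia.
rewrite addrC -addrA; congr (_ + _).
  rewrite (_ : index_iota n _ = index_iota (0 + n) (n + n).+1) //.
  rewrite big_addn (_ : ((n + n).+1 - n = n.+1)%N); last by lia.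
  by apply: eq_bigr => r _; rewrite /theta_shift leq_addl addnK addnC.
rewrite [in RHS]big_nat_recl // subn0 theta_term0 mulr1.
rewrite [in RHS]addrC addrA addNr add0r.
rewrite big_nat_rev /= add0n; apply: eq_big_nat => k /andP[_ kn].
by rewrite /theta_shift ifF ?subKn //; lia.
Qed.

(** * Bailey pairs of the unit sequence, and their second iterates *)

Lemma bailey_sum0 (F : fieldType) (q : F) (c : nat) (a : nat -> F) :
  bailey_sum q c a 0 = a 0%N / qpoch q c.
Proof. by rewrite /bailey_sum big_nat1 qpoch0 mul1r. Qed.

(** The sequence whose Bailey transform for c = 0 is the unit: the bilateral
    theta terms at z = 1, folded along r and -r.  The central term occurs in
    both halves, hence the correction at r = 0. *)
Definition unit_alpha0 (K : comPzRingType) (q : K) (r : nat) : K :=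
  theta_term q 1 r + theta_term q q r - (r == 0%N)%:R.

(** The analogue for c = 1, where the bilateral theta terms at z = 1 are folded
    along r and -1-r, the symmetry of (q)_{n-r} (q)_{n+r+1}. *)
Definition unit_alpha1 (K : comPzRingType) (q : K) (r : nat) : K :=
  theta_term q 1 r * (1 - q ^+ r.*2.+1).

Lemma theta_term_q (K : comPzRingType) (q : K) (r : nat) :
  theta_term q q r = q ^+ r * theta_term q 1 r.
Proof. by rewrite -theta_term_mulq mul1r. Qed.

Lemma theta_term_q1S (K : comPzRingType) (q : K) (r : nat) :
  theta_term q q r = - theta_term q 1 r.+1.
Proof. by rewrite theta_term_q theta_termS; ring. Qed.

(** For positive length the partial sums have a closed form.  It is written
    for n = m + 1 + d, so that its denominator (q)_{n-m-1} = (q)_d involves no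
    truncated subtraction; the last term, r = n, is added separately and
    cancels the rest. *)
Lemma unit_bailey0 (F : fieldType) (q : F) (n : nat) :
  (forall k, 1 - q ^+ k.+1 != 0) ->
  bailey_sum q 0 (unit_alpha0 q) n = (n == 0%N)%:R.
Proof.
move=> hq; have hn k := qpoch_neq0 k hq.
case: n => [|n].
  by rewrite bailey_sum0 qpoch0 divr1 /unit_alpha0 !theta_term0 addrK.
have partial m d : \sum_(0 <= r < m.+1) unit_alpha0 q r /
    (qpoch q (m.+1 + d - r) * qpoch q (m.+1 + d + r + 0)) =
  theta_term q q m / (qpoch q d * qpoch q (m.+1 + d + m) * (1 - q ^+ (m.+1 + d))).
  elim: m d => [|m IH] d.
    rewrite big_nat1 subn0 !addn0 add1n /unit_alpha0 !theta_term0 addrK qpochS.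
    by field; rewrite hq hn.
  rewrite big_nat_recr //= addSnnS IH /unit_alpha0 subr0.
  rewrite (theta_term_q q m.+1) theta_term_q1S.
  have -> : (m.+1 + d.+1 - m.+1 = d.+1)%N by lia.
  have -> : (m.+1 + d.+1 + m.+1 + 0 = (m.+1 + d.+1 + m).+1)%N by lia.
  have -> : (m.+1 + d.+1 + m.+1 = (m.+1 + d.+1 + m).+1)%N by lia.
  rewrite (qpochS q d) (qpochS q (m.+1 + d.+1 + m)).
  have h1 := hq (m.+1 + d.+1 + m)%N; have h2 : 1 - q ^+ (m.+1 + d.+1) != 0.
    exact: hq (m + d.+1)%N.
  move: h1 h2; have -> : ((m.+1 + d.+1 + m).+1 = m.+1 + m.+1 + d.+1)%N by lia.
  rewrite !exprD => h1 h2.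
  by field; rewrite !hn hq h1 h2.
rewrite /bailey_sum big_nat_recr //=.
have := partial n 0%N; rewrite addn0 => ->.
rewrite subnn qpoch0 /unit_alpha0 subr0.
rewrite (theta_term_q q n.+1) theta_term_q1S.
rewrite addn0 addnS (qpochS q (n.+1 + n)).
have h1 := hq (n.+1 + n)%N; move: h1; rewrite -addnS !exprD => h1.
by field; rewrite !hn hq h1.
Qed.

(** The same telescoping, with the extra factor 1 - q^(m+1) in the closed
    form. *)
Lemma unit_bailey1 (F : fieldType) (q : F) (n : nat) :
  (forall k, 1 - q ^+ k.+1 != 0) ->
  bailey_sum q 1 (unit_alpha1 q) n = (n == 0%N)%:R.
Proof.
move=> hq; have hn k := qpoch_neq0 k hq.
case: n => [|n].
  rewrite bailey_sum0 /unit_alpha1 theta_term0 qpochS qpoch0 !mul1r.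
  by rewrite divff ?hq.
have partial m d : \sum_(0 <= r < m.+1) unit_alpha1 q r /
    (qpoch q (m.+1 + d - r) * qpoch q (m.+1 + d + r + 1)) =
  theta_term q q m * (1 - q ^+ m.+1) /
    (qpoch q d * qpoch q (m.+1 + d + m.+1) * (1 - q ^+ (m.+1 + d))).
  elim: m d => [|m IH] d.
    rewrite big_nat1 subn0 !addn0 add1n /unit_alpha1 !theta_term0 qpochS.
    by field; rewrite hq !hn.
  rewrite big_nat_recr //= addSnnS IH /unit_alpha1.
  rewrite (theta_term_q q m.+1) theta_term_q1S.
  have -> : (m.+1 + d.+1 - m.+1 = d.+1)%N by lia.
  have -> : (m.+1 + d.+1 + m.+1 + 1 = (m.+1 + d.+1 + m.+1).+1)%N by lia.
  have -> : (m.+1 + d.+1 + m.+2 = (m.+1 + d.+1 + m.+1).+1)%N by lia.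
  rewrite (qpochS q d) (qpochS q (m.+1 + d.+1 + m.+1)).
  have h1 := hq (m.+1 + d.+1 + m.+1)%N; have h2 : 1 - q ^+ (m.+1 + d.+1) != 0.
    exact: hq (m + d.+1)%N.
  have -> : (m.+1.*2.+1 = m.+1 + m.+2)%N by lia.
  move: h1 h2.
  have -> : ((m.+1 + d.+1 + m.+1).+1 = m.+1 + m.+2 + d.+1)%N by lia.
  rewrite !exprD (exprS q m.+1) => h1 h2.
  by field; rewrite !hn hq h1 h2.
rewrite /bailey_sum big_nat_recr //=.
have := partial n 0%N; rewrite addn0 => ->.
rewrite subnn qpoch0 /unit_alpha1.
rewrite theta_term_q1S.
rewrite addn1 (qpochS q (n.+1 + n.+1)).
have -> : (n.+1.*2.+1 = (n.+1 + n.+1).+1)%N by lia.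
by field; rewrite !hn !hq.
Qed.

(** In the first step only the term t = 0 survives, giving the transform
    1/(q)_s; the second step sums these. *)
Lemma bailey_chain2 (F : fieldType) (q : F) (c : nat) (a : nat -> F) (n : nat) :
  (forall k, 1 - q ^+ k.+1 != 0) ->
  (forall m, bailey_sum q c a m = (m == 0%N)%:R) ->
  bailey_sum q c (fun r => q ^+ (r ^ 2 + c * r) * (q ^+ (r ^ 2 + c * r) * a r)) n
  = \sum_(0 <= s < n.+1) q ^+ (s ^ 2 + c * s) / qpoch q s * (qpoch q (n - s))^-1.
Proof.
move=> hq ha; rewrite bailey_lemma //; apply: eq_bigr => s _.
rewrite bailey_lemma // big_nat_recl // big1 ?addr0 => [|t _]; last first.
  by rewrite ha mulr0.
by rewrite ha subn0 muln0 mulr1 expr0 div1r mulrAC.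
Qed.

(** Two steps of the chain multiply the base of the theta series from q to
    q^5; for c = 0 this is 2 r^2 + r (r-1)/2 = 5 r (r-1)/2 + 2 r. *)
Lemma theta_term_unit_twist (K : comPzRingType) (q : K) (c r : nat) :
  q ^+ (r ^ 2 + c * r) * (q ^+ (r ^ 2 + c * r) * theta_term q 1 r) =
  theta_term (q ^+ 5) (q ^+ (2 + 2 * c)) r.
Proof.
elim: r => [|r IH]; first by rewrite muln0 !theta_term0 !mulr1.
rewrite [RHS]theta_termS -IH theta_termS.
have -> : (r.+1 ^ 2 + c * r.+1 = r ^ 2 + c * r + (r + r + 1 + c))%N by nia.
rewrite -exprM (_ : (5 * r = r + r + r + r + r)%N); last by lia.
rewrite (_ : (2 + 2 * c = 1 + 1 + c + c)%N); last by lia.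
by rewrite !exprD; ring.
Qed.

Lemma unit_alpha0_twist (K : comPzRingType) (q : K) (r : nat) :
  q ^+ (r ^ 2 + 0 * r) * (q ^+ (r ^ 2 + 0 * r) * unit_alpha0 q r) =
  theta_term (q ^+ 5) (q ^+ 2) r + theta_term (q ^+ 5) (q ^+ 3) r
  - (r == 0%N)%:R.
Proof.
have -> : theta_term (q ^+ 5) (q ^+ 3) r = q ^+ r * theta_term (q ^+ 5) (q ^+ 2) r.
  by rewrite /theta_term exprS -mulrN exprMn mulrA.
have <- := theta_term_unit_twist q 0 r.
rewrite /unit_alpha0 theta_term_q.
by case: r => [|r] /=; rewrite ?theta_term0; ring.
Qed.

Lemma unit_alpha1_twist (K : comPzRingType) (q : K) (r : nat) :
  q ^+ (r ^ 2 + 1 * r) * (q ^+ (r ^ 2 + 1 * r) * unit_alpha1 q r) =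
  theta_term (q ^+ 5) (q ^+ 4) r + theta_term (q ^+ 5) q r.+1.
Proof.
have -> : theta_term (q ^+ 5) q r.+1 =
    - q ^+ (2 * r + 1) * theta_term (q ^+ 5) (q ^+ 4) r.
  rewrite theta_termS /theta_term (exprNn q) (exprNn (q ^+ 4)) -(exprM q 5 r) -(exprM q 4 r).
  rewrite (_ : (5 * r = r + r + r + r + r)%N); last by lia.
  rewrite (_ : (4 * r = r + r + r + r)%N); last by lia.
  rewrite (_ : (2 * r + 1 = r + r + 1)%N); last by lia.
  by rewrite !exprD; ring.
rewrite (_ : (4 = 2 + 2 * 1)%N) // -theta_term_unit_twist /unit_alpha1.
by rewrite (_ : (r.*2.+1 = 2 * r + 1)%N); [ring | lia].
Qed.

(** * Completeness for geometrically dominated series *)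

(** This fragment of completeness suffices for all the limits below, and is
    stated over the field itself, in which norms and bounds also live. *)
Definition geometric_complete (K : numFieldType) : Prop :=
  forall (u : nat -> K) (B rho : K), 0 <= rho -> rho < 1 ->
  (forall n, `|u n| <= B * rho ^+ n) -> exists l : K, series u @ \oo --> l.

Lemma Re_Im_le_norm (R : realType) (z : R[i]) :
  (`|complex.Re z|%:C <= `|z|) && (`|complex.Im z|%:C <= `|z|).
Proof.
case: z => a b; rewrite normc_def /= !lecR.
by rewrite -!sqrtr_sqr !ler_wsqrtr // ?lerDl ?lerDr sqr_ge0.
Qed.

(** A positive complex number is real, so the bound can be split between the
    two components. *)
Lemma cvg_complex (R : realType) (u v : nat -> R) (a b : R) :
  u @ \oo --> a -> v @ \oo --> b ->
  (fun n => u n +i* v n : (R[i] : numFieldType)) @ \oo --> (a +i* b : (R[i] : numFieldType)).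
Proof.
move=> /cvgrPdist_lt ua /cvgrPdist_lt vb; apply/cvgrPdist_lt => e e0.
have [er eE] : exists er : R, e = er%:C.
  by exists (complex.Re e); rewrite RRe_real // ger0_real // ltW.
move: e0; rewrite {}eE ltcR => e0.
have e2 : 0 < er / 2 by lra.
near=> n.
have h1 : `|a - u n| < er / 2 by near: n; exact: ua.
have h2 : `|b - v n| < er / 2 by near: n; exact: vb.
have -> : (a +i* b) - (u n +i* v n) = (a - u n)%:C + (0 +i* (b - v n)) :> R[i].
  by apply/eqP; rewrite eq_complex /= addr0 add0r !eqxx.
apply: le_lt_trans (ler_normD _ _) _.
rewrite !normc_def /= !expr0n /= addr0 add0r !sqrtr_sqr -rmorphD /= ltcR.
lra.
Unshelve. all: by end_near.
Qed.

(** Real and imaginary parts are dominated by the same geometric series. *)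
Lemma geometric_complete_complex (R : realType) : geometric_complete R[i].
Proof.
move=> u B rho rho0 rho1 hu.
have [r rE] : exists r : R, rho = r%:C.
  by exists (complex.Re rho); rewrite RRe_real // ger0_real.
subst rho.
have B0 : 0 <= B by have := le_trans (normr_ge0 _) (hu 0%N); rewrite expr0 mulr1.
have [b bE] : exists b : R, B = b%:C.
  by exists (complex.Re B); rewrite RRe_real // ger0_real.
subst B; move: rho0 rho1; rewrite lecR ltcR => r0 r1.
have geo (v : nat -> R) : (forall n, `|v n|%:C <= `|u n|) -> cvgn (series v).
  move=> vu; apply: normed_cvg; apply: (@series_le_cvg _ _ (geometric b r)).
  - by move=> n; exact: normr_ge0.
  - by move=> n; rewrite /= mulr_ge0 ?exprn_ge0 // -lecR.
  - move=> n /=; rewrite -lecR rmorphM rmorphXn /=.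
    by exact: le_trans (vu n) (hu n).
  - by apply: is_cvg_geometric_series; rewrite ger0_norm.
have /cvg_ex[a ha] : cvgn (series (fun n => complex.Re (u n))).
  by apply: geo => n; have /andP[] := Re_Im_le_norm (u n).
have /cvg_ex[c hc] : cvgn (series (fun n => complex.Im (u n))).
  by apply: geo => n; have /andP[] := Re_Im_le_norm (u n).
exists (a +i* c).
suff -> : series u = (fun n => series (fun k => complex.Re (u k)) n +i*
    series (fun k => complex.Im (u k)) n) by exact: cvg_complex ha hc.
apply/funext; elim=> [|n]; rewrite /series /=; first by rewrite !big_geq.
move=> IH; by rewrite !big_nat_recr //= IH; case: (u n).
Qed.

(** * Passage to the limit under a geometric bound *)

Lemma seq_cvg_unique (K : numFieldType) (u : nat -> K) (a b : K) :
  u @ \oo --> a -> u @ \oo --> b -> a = b.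
Proof. by move=> ua; apply: cvg_unique ua; exact: norm_hausdorff. Qed.

Lemma cvg_mulnl (m : nat) : (0 < m)%N -> (m * n)%N @[n --> \oo] --> \oo.
Proof.
move=> m0; apply/cvgnyPge => A; near=> n.
apply: leq_trans (leq_pmull n m0); near: n; exact: nbhs_infty_ge.
Unshelve. all: by end_near.
Qed.

Lemma series_delta0_cvg (K : numFieldType) :
  series (fun r => (r == 0%N)%:R : K) @ \oo --> (1 : K).
Proof.
pose d (r : nat) : K := (r == 0%N)%:R.
have dE : (fun n => series d n.+1) = fun=> 1.
  by apply/funext => n; rewrite /series /= big_nat_recl // big1 ?addr0.
by rewrite -(cvg_shiftS (series d)) dE; exact: cvg_cst.
Qed.

Lemma expr_cvg0 (K : numFieldType) (rho : K) : geometric_complete K ->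
  0 <= rho -> rho < 1 -> rho ^+ n @[n --> \oo] --> 0.
Proof.
move=> hK r0 r1; apply: cvg_series_cvg_0; apply/cvg_ex.
apply: (hK _ 1 rho) => // n.
by rewrite mul1r ger0_norm ?exprn_ge0.
Qed.

Lemma geometric_tail (K : numFieldType) (rho : K) (m n : nat) :
  0 <= rho -> rho < 1 ->
  \sum_(m <= k < n) rho ^+ k <= rho ^+ m / (1 - rho).
Proof.
move=> r0 r1; have h : 0 < 1 - rho by rewrite subr_gt0.
case: (leqP m n) => [mn|nm]; last first.
  by rewrite big_geq ?(ltnW nm) // divr_ge0 ?exprn_ge0 ?(ltW h).
rewrite ler_pdivlMr // mulrBr mulr1 big_distrl /= -sumrB.
under eq_bigr do rewrite -exprSr.
rewrite -(opprK (\sum_(_ <= _ < _) _)) -sumrN.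
under eq_bigr do rewrite opprB.
by rewrite telescope_sumr // opprB lerBlDr lerDl exprn_ge0.
Qed.

(** Dominated convergence for sums of growing length.  The terms are split as
    [g k * c n k] with a weight [c] whose limit does not depend on [k]: all the
    sums below have this shape, and the limit then factors. *)
Lemma tannery_geometric (K : numFieldType) (g : nat -> K) (c : nat -> nat -> K)
  (B rho M G L : K) : geometric_complete K ->
  0 <= rho -> rho < 1 -> (forall k, `|g k| <= B * rho ^+ k) ->
  (forall n k, (k <= n)%N -> `|c n k| <= M) ->
  (forall k, c n k @[n --> \oo] --> L) ->
  series g @ \oo --> G ->
  \sum_(0 <= k < n.+1) g k * c n k @[n --> \oo] --> G * L.
Proof.
move=> hK r0 r1 hg hc cL gG.
have B0 : 0 <= B by have := le_trans (normr_ge0 _) (hg 0%N); rewrite expr0 mulr1.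
have M0 : 0 <= M by apply: le_trans (normr_ge0 _) (hc 0%N 0%N _).
have h1r : 0 < 1 - rho by rewrite subr_gt0.
pose M' := M + `|L|.
have M'0 : 0 <= M' by rewrite addr_ge0.
pose D n := \sum_(0 <= k < n.+1) g k * (c n k - L).
(* It is enough to treat the difference with the partial sums of [g] times [L]. *)
suff D0 : D n @[n --> \oo] --> 0.
  have gS : series g n.+1 @[n --> \oo] --> G by rewrite (cvg_shiftS (series g)).
  rewrite (_ : (fun n => _) = (fun n => D n + series g n.+1 * L)); last first.
    apply/funext => n; rewrite /D /series /= big_distrl -big_split /=.
    by apply: eq_bigr => k _; ring.
  by rewrite -(add0r (G * L)); apply: cvgD D0 _; apply: cvgM gS _; exact: cvg_cst.
apply/cvgr0Pnorm_le => e e0.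
(* The cut-off m makes the tail beyond it small uniformly in n. *)
have [m hm] : exists m, B * M' * (rho ^+ m / (1 - rho)) <= e / 2.
  have hz : B * M' / (1 - rho) * rho ^+ n @[n --> \oo] --> 0.
    by rewrite -[X in _ --> X](mulr0 (B * M' / (1 - rho)));
      apply: cvgM; [exact: cvg_cst | exact: expr_cvg0].
  have /cvgr0Pnorm_le/(_ (e / 2)) := hz.
  rewrite divr_gt0 // => /(_ isT) [m _ /(_ m (leqnn m))] /=.
  rewrite ger0_norm; first by move=> h; exists m; apply: le_trans h; rewrite le_eqVlt; apply/orP; left; apply/eqP; ring.
  by rewrite mulr_ge0 ?exprn_ge0 // divr_ge0 ?mulr_ge0 // ltW.
have fin : \sum_(0 <= k < m) g k * (c n k - L) @[n --> \oo] --> 0.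
  rewrite -[X in _ --> X](_ : \sum_(0 <= k < m) g k * (L - L) = 0); last first.
    by rewrite big1 // => k _; rewrite subrr mulr0.
  apply: cvg_big; first exact: add_continuous.
  by move=> k _; apply: cvgM; [exact: cvg_cst | apply: cvgB; [exact: cL | exact: cvg_cst]].
have /cvgr0Pnorm_le/(_ (e / 2)) := fin; rewrite divr_gt0 // => /(_ isT) hfin.
near=> n.
have mn : (m <= n.+1)%N by near: n; exists m => // n /= /leqW.
rewrite /D (big_cat_nat (n := m)) //= (splitr e).
apply: le_trans (ler_normD _ _) _; apply: lerD; first by near: n.
apply: le_trans (ler_norm_sum _ _ _) _; apply: le_trans hm.
apply: (@le_trans _ _ (\sum_(m <= k < n.+1) B * M' * rho ^+ k)).
  rewrite big_nat_cond [leRHS]big_nat_cond; apply: ler_sum => k /andP[/andP[_ kn] _].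
  rewrite normrM mulrAC; apply: ler_pM => //.
  by apply: le_trans (ler_normB _ _) _; rewrite lerD2r; apply: hc.
by rewrite -big_distrr /= ler_wpM2l ?mulr_ge0 // geometric_tail.
Unshelve. all: by end_near.
Qed.

(** * Convergence of infinite products *)

(** The products Q_n satisfy Q_n <= 2 Q_m (1 - c rho^n) for n >= m, where
    c = C / (1 - rho): this bound is inductive because
    (1 - c x) (1 + C x) <= 1 - c rho x, and it starts as soon as
    c rho^m <= 1/2. *)
Lemma prod_geometric_bounded (K : numFieldType) (C rho : K) :
  geometric_complete K -> 0 <= rho -> rho < 1 -> 0 <= C ->
  exists2 M : K, 0 <= M &
    forall n, \prod_(0 <= k < n) (1 + C * rho ^+ k) <= M.
Proof.
move=> hK r0 r1 C0; have h : 0 < 1 - rho by rewrite subr_gt0.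
have [c c0 Cc] : exists2 c, 0 <= c & C = c * (1 - rho).
  by exists (C / (1 - rho)); rewrite ?divfK ?gt_eqF // divr_ge0 // ltW.
pose Q n : K := \prod_(0 <= k < n) (1 + C * rho ^+ k).
have QS n : Q n.+1 = Q n * (1 + C * rho ^+ n) by rewrite /Q big_nat_recr.
have f0 n : 0 <= C * rho ^+ n by rewrite mulr_ge0 ?exprn_ge0.
have Q0 n : 0 <= Q n.
  by apply: prodr_ge0 => k _; rewrite addr_ge0.
have [m hm] : exists m, c * rho ^+ m <= 1 / 2.
  have hz : c * rho ^+ n @[n --> \oo] --> 0.
    by rewrite -[X in _ --> X](mulr0 c);
      apply: cvgM; [exact: cvg_cst | exact: expr_cvg0].
  have half_gt0 : 0 < 1 / 2 :> K by rewrite divr_gt0.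
  have /cvgr0Pnorm_le/(_ _ half_gt0) [m _ /(_ m (leqnn m))] /= := hz.
  by rewrite ger0_norm ?mulr_ge0 ?exprn_ge0 // => ?; exists m.
(* The inductive bound, started at m. *)
have step n : Q (n + m)%N <= 2 * Q m * (1 - c * rho ^+ (n + m)).
  elim: n => [|n IH].
    rewrite add0n -mulrA mulrCA ler_peMr // mulrBr mulr1 lerBrDr.
    rewrite -lerBrDl; have -> : 2 - 1 = 1 :> K by ring.
    by rewrite mulrC -ler_pdivlMr.
  rewrite addSn QS.
  apply: le_trans (ler_wpM2r _ IH) _; first by rewrite addr_ge0.
  rewrite -(mulrA (2 * Q m)) ler_wpM2l ?mulr_ge0 // exprS.
  set x := rho ^+ (n + m).
  have x0 : 0 <= x by rewrite exprn_ge0.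
  rewrite Cc -subr_ge0.
  have -> : 1 - c * (rho * x) - (1 - c * x) * (1 + c * (1 - rho) * x) =
    c * c * (1 - rho) * x * x by ring.
  by rewrite !mulr_ge0 // ltW.
exists (2 * Q m) => [|n]; first by rewrite mulr_ge0.
apply: (@le_trans _ _ (Q (n + m)%N)).
  elim: (m) => [|j IH]; first by rewrite addn0.
  by rewrite addnS QS; apply: le_trans IH _; rewrite ler_peMr // lerDl.
apply: le_trans (step n) _; rewrite ler_piMr ?mulr_ge0 //.
by rewrite lerBlDr lerDl mulr_ge0 ?exprn_ge0.
Qed.

(** The successive differences of the partial products are dominated by a
    geometric series, since the partial products are bounded. *)
Lemma prod_cvg_bounded (K : numFieldType) (u : nat -> K) (C rho : K) :
  geometric_complete K -> 0 <= rho -> rho < 1 ->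
  (forall k, `|u k| <= C * rho ^+ k) ->
  (exists l : K, \prod_(0 <= k < n) (1 + u k) @[n --> \oo] --> l) /\
  (exists M : K, forall n, `|\prod_(0 <= k < n) (1 + u k)| <= M).
Proof.
move=> hK r0 r1 hu.
have C0 : 0 <= C by have := le_trans (normr_ge0 _) (hu 0%N); rewrite expr0 mulr1.
have [M M0 hM] := prod_geometric_bounded hK r0 r1 C0.
pose P n : K := \prod_(0 <= k < n) (1 + u k).
have PM n : `|P n| <= M.
  apply: le_trans (hM n); rewrite /P normr_prod; apply: ler_prod => k _.
  by rewrite normr_ge0 /=; apply: le_trans (ler_normD _ _) _; rewrite normr1 lerD2l.
split; last by exists M.
have [|l hl] := hK (fun n => P n.+1 - P n) (M * C) rho r0 r1.
  move=> n; rewrite /P big_nat_recr //= mulrDr mulr1 addrC addKr normrM -mulrA.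
  by apply: ler_pM => //; exact: PM.
exists (1 + l).
rewrite (_ : (fun n => _) = (fun n => 1 + series (fun n => P n.+1 - P n) n)).
  by apply: cvgD hl; exact: cvg_cst.
apply/funext => n; rewrite /series /= telescope_sumr //.
by rewrite (_ : P 0%N = 1) 1?addrC ?subrK // /P big_geq.
Qed.

(** The inverse partial products are again of the form prod (1 + v_k), with
    v = a / (1 - a) geometrically small; so both limits exist, and as their
    product is 1 neither vanishes. *)
Lemma prod_sub_cvg_bounded (K : numFieldType) (a : nat -> K) (rho : K) :
  geometric_complete K -> 0 <= rho -> rho < 1 ->
  (forall k, `|a k| <= rho ^+ k.+1) ->
  (exists2 l : K, l != 0 & \prod_(0 <= k < n) (1 - a k) @[n --> \oo] --> l) /\
  (exists M : K, forall n, `|\prod_(0 <= k < n) (1 - a k)| <= M /\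
     `|(\prod_(0 <= k < n) (1 - a k))^-1| <= M).
Proof.
move=> hK r0 r1 ha; have h : 0 < 1 - rho by rewrite subr_gt0.
have arho k : `|a k| <= rho.
  by apply: le_trans (ha k) _; rewrite exprS ler_piMr // exprn_ile1 // ltW.
have a1 k : 1 - rho <= `|1 - a k|.
  apply: le_trans (lerB_dist _ _); rewrite normr1.
  by rewrite lerD2l lerN2.
have a_neq0 k : 1 - a k != 0 by rewrite -normr_gt0 (lt_le_trans h).
pose v k := a k / (1 - a k).
have hu k : `|- a k| <= 1 * rho ^+ k.
  rewrite normrN mul1r; apply: le_trans (ha k) _.
  by rewrite exprS ler_piMl ?exprn_ge0 // ltW.
have hv k : `|v k| <= (1 - rho)^-1 * rho ^+ k.
  rewrite /v normrM mulrC; apply: ler_pM => //.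
    by rewrite normfV lef_pV2 // ?posrE ?normr_gt0.
  by rewrite -normrN -[leRHS]mul1r.
have [[l hl] [M hM]] := prod_cvg_bounded hK r0 r1 hu.
have [[l' hl'] [M' hM']] := prod_cvg_bounded hK r0 r1 hv.
have invE n : \prod_(0 <= k < n) (1 + v k) = (\prod_(0 <= k < n) (1 - a k))^-1.
  rewrite -prodfV; apply: eq_bigr => k _; rewrite /v; field; exact: a_neq0.
have P0 n : \prod_(0 <= k < n) (1 - a k) != 0.
  by rewrite prodf_seq_neq0; apply/allP => k _; exact: a_neq0.
have ll' : l * l' = 1.
  apply: seq_cvg_unique (cvgM hl hl') _; rewrite (_ : _ \* _ = fun=> 1).
    exact: cvg_cst.
  by apply/funext => n /=; rewrite invE divff.
split.
  exists l => //; apply/eqP => l0; move/eqP: ll'.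
  by rewrite l0 mul0r eq_sym oner_eq0.
have M0 : 0 <= M by apply: le_trans (hM 0%N).
have M'0 : 0 <= M' by apply: le_trans (hM' 0%N).
exists (M + M') => n; split.
  by apply: le_trans (hM n) _; rewrite lerDl.
by rewrite -invE; apply: le_trans (hM' n) _; rewrite lerDr.
Qed.

Lemma one_sub_expr_neq0 (K : numFieldType) (q : K) (k : nat) :
  `|q| < 1 -> 1 - q ^+ k.+1 != 0.
Proof.
move=> hq; rewrite subr_eq0; apply/eqP => qk.
have : `|q ^+ k.+1| < 1 by rewrite normrX exprn_ilt1.
by rewrite -qk normr1 ltxx.
Qed.

Lemma qpoch_cvg_bounded (K : numFieldType) (q : K) :
  geometric_complete K -> `|q| < 1 ->
  (exists2 l : K, l != 0 & qpoch q n @[n --> \oo] --> l) /\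
  (exists M : K, forall n, `|qpoch q n| <= M /\ `|(qpoch q n)^-1| <= M).
Proof.
move=> hK hq; rewrite (_ : (fun n => qpoch q n) =
  (fun n => \prod_(0 <= k < n) (1 - q ^+ k.+1))); last first.
  by apply/funext => n; rewrite qpochE.
have [||h1 [M hM]] := @prod_sub_cvg_bounded K (fun k => q ^+ k.+1) `|q| hK _ hq.
- exact: normr_ge0.
- by move=> k; rewrite normrX.
by split => //; exists M => n; rewrite qpochE.
Qed.

(** * Limits of the finite identities *)

Lemma norm_theta_term (K : numFieldType) (p z : K) (r : nat) :
  `|p| < 1 -> `|theta_term p z r| <= `|z| ^+ r.
Proof.
move=> hp; rewrite /theta_term normrM normrX normrN ler_piMr ?exprn_ge0 //.
by rewrite normrX exprn_ile1 // ltW.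
Qed.

(** Limit of the finite identity: the Gaussian binomials of 2 n over n + r and
    over n - r tend to 1/(p)_oo for every fixed r and are uniformly bounded. *)
Lemma jacobi_triple_product (K : numFieldType) (p z w l Z W : K) :
  geometric_complete K -> `|z| < 1 -> `|w| < 1 -> z * w = p ->
  l != 0 ->
  qpoch p n @[n --> \oo] --> l ->
  \prod_(0 <= j < n) (1 - z * p ^+ j) @[n --> \oo] --> Z ->
  \prod_(0 <= j < n) (1 - w * p ^+ j) @[n --> \oo] --> W ->
  exists Jz Jw : K, [/\ series (theta_term p z) @ \oo --> Jz,
    series (theta_term p w) @ \oo --> Jw & Jz + Jw - 1 = l * Z * W].
Proof.
move=> hK hz hw zw l0 hl hZ hW.
have hp : `|p| < 1.
  by rewrite -zw normrM; apply: le_lt_trans hw; rewrite ler_piMl // ltW.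
have hpn k := one_sub_expr_neq0 k hp.
have bound x : forall r, `|theta_term p x r| <= 1 * `|x| ^+ r.
  by move=> r; rewrite mul1r norm_theta_term.
have [Jz hJz] := hK _ 1 _ (normr_ge0 z) hz (bound z).
have [Jw hJw] := hK _ 1 _ (normr_ge0 w) hw (bound w).
exists Jz, Jw; split => //.
have [_ [M hM]] := qpoch_cvg_bounded hK hp.
have M0 : 0 <= M by apply: le_trans (hM 0%N).1.
have qbM n k : (k <= n)%N -> `|qbin p n k| <= M * (M * M).
  move=> kn; rewrite qbinE // invfM !normrM; apply: ler_pM => //.
  - exact: (hM n).1.
  - by apply: ler_pM => //; apply: (hM _).2.
have hnn : qpoch p (n + n) @[n --> \oo] --> l.
  rewrite (_ : (fun n => _) = qpoch p \o (fun n => 2 * n)%N).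
    by apply: cvg_comp hl; exact: cvg_mulnl.
  by apply/funext => n /=; rewrite mul2n addnn.
have core r : qpoch p (n + n) / (qpoch p (n + r) * qpoch p (n - r))
     @[n --> \oo] --> l / (l * l).
  apply: cvgM => //; apply: cvgV; first by rewrite mulf_neq0.
  by apply: cvgM; [rewrite (cvg_shiftn r (qpoch p)) | rewrite (cvg_centern r (qpoch p))].
have ll : l / (l * l) = l^-1 by field.
have qb1 r : qbin p (n + n) (n + r) @[n --> \oo] --> l^-1.
  rewrite -ll; apply: cvg_trans (core r); apply: near_eq_cvg; near=> n.
  have rn : (r <= n)%N by near: n; exact: nbhs_infty_ge.
  rewrite qbinE //; last by lia.
  by rewrite (_ : (n + n - (n + r) = n - r)%N) //; lia.
have qb2 r : qbin p (n + n) (n - r) @[n --> \oo] --> l^-1.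
  rewrite -ll; apply: cvg_trans (core r); apply: near_eq_cvg; near=> n.
  have rn : (r <= n)%N by near: n; exact: nbhs_infty_ge.
  rewrite qbinE //; last by lia.
  by rewrite (_ : (n + n - (n - r) = n + r)%N); [rewrite (mulrC (qpoch p (n - r))) | lia].
have T1 := @tannery_geometric K (theta_term p z)
  (fun n r => qbin p (n + n) (n + r)) 1 `|z| (M * (M * M)) Jz l^-1 hK
  (normr_ge0 _) hz (bound z) _ qb1 hJz.
have T2 := @tannery_geometric K (theta_term p w)
  (fun n r => qbin p (n + n) (n - r)) 1 `|w| (M * (M * M)) Jw l^-1 hK
  (normr_ge0 _) hw (bound w) _ qb2 hJw.
have qb0 : qbin p (n + n) n @[n --> \oo] --> l^-1.
  by have := qb1 0%N; rewrite (_ : (fun n => _) = (fun n => qbin p (n + n) n)) //;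
    apply/funext => n; rewrite addn0.
have E : Z * W = Jz * l^-1 + Jw * l^-1 - l^-1.
  apply: seq_cvg_unique (cvgM hZ hW) _.
  rewrite (_ : _ \* _ = fun n =>
    \sum_(0 <= r < n.+1) theta_term p z r * qbin p (n + n) (n + r) +
    \sum_(0 <= r < n.+1) theta_term p w r * qbin p (n + n) (n - r) -
    qbin p (n + n) n).
    apply: cvgB => //; apply: cvgD; [apply: T1 | apply: T2] => n k kn;
      apply: qbM; lia.
  apply/funext => n /=; rewrite finite_triple_product_folded //.
  by congr (_ + _ - _); apply: eq_bigr => r _; rewrite mulrC.
by rewrite -mulrA E; field.
Unshelve. all: by end_near.
Qed.

(** Both sides of the twice iterated identity are limits under a geometric
    bound, to S/l and A/l^2 respectively, where S is the series sought. *)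
Lemma bailey_limit (K : numFieldType) (q : K) (c : nat) (a : nat -> K)
  (B A l : K) :
  geometric_complete K -> `|q| < 1 ->
  (forall m, bailey_sum q c a m = (m == 0%N)%:R) ->
  (forall r, `|q ^+ (r ^ 2 + c * r) * (q ^+ (r ^ 2 + c * r) * a r)|
     <= B * `|q| ^+ r) ->
  series (fun r => q ^+ (r ^ 2 + c * r) * (q ^+ (r ^ 2 + c * r) * a r))
    @ \oo --> A ->
  l != 0 -> qpoch q n @[n --> \oo] --> l ->
  series (fun s => q ^+ (s ^ 2 + c * s) / qpoch q s) @ \oo --> A / l.
Proof.
move=> hK hq ha hB hA l0 hl.
have hqn k := one_sub_expr_neq0 k hq.
have [_ [M hM]] := qpoch_cvg_bounded hK hq.
have M0 : 0 <= M by apply: le_trans (hM 0%N).1.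
pose g s := q ^+ (s ^ 2 + c * s) / qpoch q s.
have gM s : `|g s| <= M * `|q| ^+ s.
  rewrite normrM mulrC; apply: ler_pM => //; first exact: (hM s).2.
  rewrite normrX; apply: ler_wiXn2l => //; first exact: ltW.
  nia.
have [S hS] := hK g M _ (normr_ge0 q) hq gM.
have inv_sub s : (qpoch q (n - s))^-1 @[n --> \oo] --> l^-1.
  by apply: cvgV => //; rewrite (cvg_centern s (qpoch q)).
have T1 := @tannery_geometric K g (fun n s => (qpoch q (n - s))^-1) M `|q| M S
  l^-1 hK (normr_ge0 _) hq gM (fun n k _ => (hM (n - k)%N).2) inv_sub hS.
have inv2 r : (qpoch q (n - r) * qpoch q (n + r + c))^-1 @[n --> \oo]
    --> (l * l)^-1.
  apply: cvgV; first by rewrite mulf_neq0.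
  apply: cvgM; first by rewrite (cvg_centern r (qpoch q)).
  rewrite (_ : (fun n => _) = (fun n => qpoch q (n + (r + c)))).
    by rewrite (cvg_shiftn (r + c) (qpoch q)).
  by apply/funext => n; rewrite addnA.
have T2 := @tannery_geometric K _
  (fun n r => (qpoch q (n - r) * qpoch q (n + r + c))^-1) B `|q| (M * M) A
  (l * l)^-1 hK (normr_ge0 _) hq hB _ inv2 hA.
have E : S * l^-1 = A * (l * l)^-1.
  apply: seq_cvg_unique T1 _.
  rewrite (_ : (fun n => _) = (fun n => bailey_sum q c
     (fun r => q ^+ (r ^ 2 + c * r) * (q ^+ (r ^ 2 + c * r) * a r)) n)).
    apply: T2 => n k _; rewrite invfM normrM; apply: ler_pM => //;
      exact: (hM _).2.
  by apply/funext => n; rewrite bailey_chain2.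
by rewrite (_ : A / l = S) // -[RHS](divfK l0) E; field.
Qed.

(** * The Rogers-Ramanujan identities *)

Lemma prod_residue_cvg (K : numFieldType) (q : K) (i : nat) :
  geometric_complete K -> `|q| < 1 -> (0 < i)%N ->
  exists2 L : K, L != 0 &
    \prod_(0 <= m < n) (1 - q ^+ (5 * m + i)) @[n --> \oo] --> L.
Proof.
move=> hK hq i0.
have [||h _] := @prod_sub_cvg_bounded K (fun k => q ^+ (5 * k + i)) `|q| hK _ hq.
- exact: normr_ge0.
- by move=> k; rewrite normrX ler_wiXn2l ?(ltW hq) //; lia.
exact: h.
Qed.

Lemma infprod_residue_pair (K : numFieldType) (q L1 L2 : K) (i j : nat) :
  L1 != 0 -> L2 != 0 ->
  \prod_(0 <= m < n) (1 - q ^+ (5 * m + i)) @[n --> \oo] --> L1 ->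
  \prod_(0 <= m < n) (1 - q ^+ (5 * m + j)) @[n --> \oo] --> L2 ->
  infprod_cvg_to
    (fun m => 1 / ((1 - q ^+ (5 * m + i)) * (1 - q ^+ (5 * m + j))))
    (L1 * L2)^-1.
Proof.
move=> L10 L20 h1 h2; split; last by rewrite invr_eq0 mulf_neq0.
rewrite (_ : (fun n => _) = (fun n =>
  (\prod_(0 <= m < n) (1 - q ^+ (5 * m + i)) *
   \prod_(0 <= m < n) (1 - q ^+ (5 * m + j)))^-1)).
  by apply: cvgV; [rewrite mulf_neq0 | apply: cvgM].
apply/funext => n; rewrite -big_split /= -prodfV.
by apply: eq_bigr => m _; rewrite div1r.
Qed.

(** With (q)_oo = L1 L2 L3 L4 L5 split by residues modulo 5, the theta series
    equals L5 L2 L3 for c = 0 and L5 L4 L1 for c = 1; dividing by (q)_oo leaves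
    1/(L1 L4) and 1/(L2 L3). *)
Lemma rogers_ramanujan_numField (K : numFieldType) (q : K) :
  geometric_complete K -> `|q| < 1 ->
  (exists l : K,
     series_cvg_to (fun m : nat => q ^+ (m ^ 2)%N / qpoch q m) l /\
     infprod_cvg_to
       (fun m : nat =>
          1 / ((1 - q ^+ (5 * m + 1)%N) * (1 - q ^+ (5 * m + 4)%N))) l) /\
  (exists l : K,
     series_cvg_to (fun m : nat => q ^+ (m ^ 2 + m)%N / qpoch q m) l /\
     infprod_cvg_to
       (fun m : nat =>
          1 / ((1 - q ^+ (5 * m + 2)%N) * (1 - q ^+ (5 * m + 3)%N))) l).
Proof.
move=> hK hq; have hqn k := one_sub_expr_neq0 k hq.
have [L1 L10 h1] := prod_residue_cvg hK hq (isT : 0 < 1)%N.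
have [L2 L20 h2] := prod_residue_cvg hK hq (isT : 0 < 2)%N.
have [L3 L30 h3] := prod_residue_cvg hK hq (isT : 0 < 3)%N.
have [L4 L40 h4] := prod_residue_cvg hK hq (isT : 0 < 4)%N.
have [L5 L50 h5] := prod_residue_cvg hK hq (isT : 0 < 5)%N.
have [[l l0 hl] _] := qpoch_cvg_bounded hK hq.
have lE : l = L1 * L2 * L3 * L4 * L5.
  apply: (@seq_cvg_unique _ (fun n => qpoch q (5 * n))).
    rewrite -[fun n => _]/(qpoch q \o (fun n => 5 * n)%N).
    by apply: cvg_comp hl; exact: cvg_mulnl.
  rewrite (_ : (fun n => _) = (fun n =>
     \prod_(0 <= m < n) (1 - q ^+ (5 * m + 1)) *
     \prod_(0 <= m < n) (1 - q ^+ (5 * m + 2)) *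
     \prod_(0 <= m < n) (1 - q ^+ (5 * m + 3)) *
     \prod_(0 <= m < n) (1 - q ^+ (5 * m + 4)) *
     \prod_(0 <= m < n) (1 - q ^+ (5 * m + 5)))).
    by do 4![apply: cvgM => //].
  by apply/funext => n; rewrite qpoch_mul5.
have hp5 : qpoch (q ^+ 5) n @[n --> \oo] --> L5.
  rewrite (_ : (fun n => _) =
    (fun n => \prod_(0 <= m < n) (1 - q ^+ (5 * m + 5)))) //.
  apply/funext => n; rewrite qpochE; apply: eq_bigr => m _.
  by rewrite -exprM mulnS addnC.
have lin i (L : K) : \prod_(0 <= m < n) (1 - q ^+ (5 * m + i)) @[n --> \oo] --> L ->
    \prod_(0 <= m < n) (1 - q ^+ i * (q ^+ 5) ^+ m) @[n --> \oo] --> L.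
  rewrite (_ : (fun n => \prod_(0 <= m < n) (1 - q ^+ i * _)) =
    (fun n => \prod_(0 <= m < n) (1 - q ^+ (5 * m + i)))) //.
  apply/funext => n; apply: eq_bigr => m _.
  by rewrite -exprM addnC exprD.
have qi i : `|q ^+ i.+1| < 1 by rewrite normrX exprn_ilt1.
have q5 : `|q ^+ 5| < 1 by exact: qi.
have le_theta i r : `|theta_term (q ^+ 5) (q ^+ i.+1) r| <= `|q| ^+ r.
  apply: le_trans (norm_theta_term _ _ q5) _.
  by rewrite normrX -exprM ler_wiXn2l ?(ltW hq) //; nia.
split.
- have [Jz [Jw [hJz hJw J]]] := @jacobi_triple_product K (q ^+ 5) (q ^+ 2)
    (q ^+ 3) L5 L2 L3 hK (qi _) (qi _) (esym (exprD _ _ _)) L50 hp5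
    (lin 2 _ h2) (lin 3 _ h3).
  exists (L1 * L4)^-1; split; last exact: infprod_residue_pair.
  have := @bailey_limit K q 0 (unit_alpha0 q) 3 (Jz + Jw - 1) l hK hq
    (fun m => unit_bailey0 m hqn) _ _ l0 hl.
  rewrite J lE (_ : L5 * L2 * L3 / (L1 * L2 * L3 * L4 * L5) = (L1 * L4)^-1);
    last by field; rewrite L10 L20 L30 L40 L50.
  rewrite (_ : (fun s => q ^+ (s ^ 2 + 0 * s) / qpoch q s) =
     (fun m : nat => q ^+ (m ^ 2)%N / qpoch q m)); last first.
    by apply/funext => m; rewrite mul0n addn0.
  apply.
  + move=> r; rewrite unit_alpha0_twist.
    have -> : 3 * `|q| ^+ r = `|q| ^+ r + `|q| ^+ r + `|q| ^+ r by ring.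
    apply: le_trans (ler_normB _ _) _; apply: lerD.
      by apply: le_trans (ler_normD _ _) _; apply: lerD; exact: le_theta.
    by case: r => [|r]; rewrite ?expr0 ?normr1 // normr0 exprn_ge0.
  + rewrite -J (_ : series _ = series (theta_term (q ^+ 5) (q ^+ 2)) +
      series (theta_term (q ^+ 5) (q ^+ 3)) -
      series (fun r => (r == 0%N)%:R : K)).
      by apply: cvgB; [exact: cvgD | exact: series_delta0_cvg].
    apply/funext => n; rewrite /series !fctE /= -big_split -sumrB /=.
    by apply: eq_bigr => r _; rewrite unit_alpha0_twist.
- have [Jz [Jw [hJz hJw J]]] := @jacobi_triple_product K (q ^+ 5) (q ^+ 4)
    (q ^+ 1) L5 L4 L1 hK (qi _) (qi _) (esym (exprD _ _ _)) L50 hp5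
    (lin 4 _ h4) (lin 1 _ h1).
  exists (L2 * L3)^-1; split; last exact: infprod_residue_pair.
  have := @bailey_limit K q 1 (unit_alpha1 q) 2 (Jz + Jw - 1) l hK hq
    (fun m => unit_bailey1 m hqn) _ _ l0 hl.
  rewrite J lE (_ : L5 * L4 * L1 / (L1 * L2 * L3 * L4 * L5) = (L2 * L3)^-1);
    last by field; rewrite L10 L20 L30 L40 L50.
  rewrite (_ : (fun s => q ^+ (s ^ 2 + 1 * s) / qpoch q s) =
     (fun m : nat => q ^+ (m ^ 2 + m)%N / qpoch q m)); last first.
    by apply/funext => m; rewrite mul1n.
  apply.
  + move=> r; rewrite unit_alpha1_twist.
    have -> : 2 * `|q| ^+ r = `|q| ^+ r + `|q| ^+ r by ring.
    apply: le_trans (ler_normD _ _) _; apply: lerD; first exact: le_theta.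
    apply: le_trans (le_theta 0%N r.+1) _.
    by rewrite ler_wiXn2l // ltW.
  (* The second half of the theta series starts at index 1, hence the 1
     subtracted in the triple product. *)
  + rewrite -J (_ : series _ = series (theta_term (q ^+ 5) (q ^+ 4)) +
      (fun n => series (theta_term (q ^+ 5) q) n.+1 - 1)).
      rewrite -addrA; apply: cvgD => //; apply: cvgB; last exact: cvg_cst.
      by rewrite (cvg_shiftS (series (theta_term (q ^+ 5) q))).
    apply/funext => n; rewrite /series !fctE /= big_nat_recl // theta_term0.
    rewrite (addrC 1) addrK -big_split /=.
    by apply: eq_bigr => r _; rewrite unit_alpha1_twist.
Qed.

Theorem theorem4p9 (R : realType) (q : R[i]) (hq : `|q| < 1) :
  (exists l : R[i],
     series_cvg_to (fun m : nat => q ^+ (m ^ 2)%N / qpoch q m) l /\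
     infprod_cvg_to
       (fun m : nat =>
          1 / ((1 - q ^+ (5 * m + 1)%N) * (1 - q ^+ (5 * m + 4)%N))) l) /\
  (exists l : R[i],
     series_cvg_to (fun m : nat => q ^+ (m ^ 2 + m)%N / qpoch q m) l /\
     infprod_cvg_to
       (fun m : nat =>
          1 / ((1 - q ^+ (5 * m + 2)%N) * (1 - q ^+ (5 * m + 3)%N))) l).
Proof.
exact: (rogers_ramanujan_numField (@geometric_complete_complex R) hq).
Qed.
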